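(* Let $M$ be a matrix (smoother) such that $M+M^T-A$ is symmetric positive definite and let $\overline{M}=M(M+M^T-A)^{-1}M^T$. Then the auxiliary space preconditioners with exact inversion of the mortar matrix $\mathcal{A}$, $$\tilde B^{-1}_{\mathrm{add}}=\overline{M}^{-1}+\Pi_H\,\mathcal{A}^{-1}\,\Pi_H^T,$$ $$\tilde B^{-1}_{\mathrm{mult}}=\overline{M}^{-1}+(I-M^{-T}A)\,\Pi_H\,\mathcal{A}^{-1}\,\Pi_H^T\,(I-AM^{-1}),$$ are symmetric positive definite.
   Context: **Mesh and original problem.** $\Omega\subset\mathbb{R}^d$ is a domain with Lipschitz boundary, $\mathcal{T}^h$ a triangulation of $\Omega$, and $\mathcal{U}^h\subset H^1_0(\Omega)$ the space of continuous piecewise polynomial finite element functions on $\mathcal{T}^h$ with the usual nodal degrees of freedom (dofs). Functions are identified with their coefficient vectors. $\kappa\in L^\infty(\Omega)$, $\kappa>0$, and $A$ is the symmetric positive definite (SPD) stiffness matrix of $a(u,v)=\int_\Omega\kappa\nabla u\cdot\nabla v$ on $\mathcal{U}^h$. $\mathcal{T}^H$ is a partition of $\mathcal{T}^h$ into non-overlapping connected sets $T$ of elements (agglomerates). $A_T$ is the symmetric positive semidefinite (SPSD) stiffness matrix of the same form restricted to $T$, on the dofs contained in $T$; $A=\sum_T A_T$ (with implicit local-to-global mapping); the null space of $A_T$ is either trivial or spanned by the constant vector, and at least one $A_T$ is nonsingular because of the essential boundary condition. $\Phi^H$ is the set of agglomerate faces: each $F\in\Phi^H$ is the $(d-1)$-dimensional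 interface, a union of fine faces, between two adjacent agglomerates $T_+,T_-\in\mathcal{T}^H$; then $F\subset\partial T_\pm$. **Nonconforming spaces.** $\mathcal{E}^h$ consists of functions on $\Omega$ whose restriction to each $T\in\mathcal{T}^H$ is the restriction of some function in $\mathcal{U}^h$, with no continuity between different $T$; its degrees of freedom (edofs) are obtained by giving each $T$ its own copy of every dof contained in $T$. For a dof $l$, $J_l$ is the set of its copies. $\mathcal{F}^h$ consists of functions on $\bigcup_F F$ that on each $F\in\Phi^H$ are traces of functions in $\mathcal{U}^h$; its degrees of freedom (bdofs) are copies, one for each $F$, of the dofs contained in $F$. $\cdot|_T$ and $\cdot|_F$ denote the corresponding subvectors. Subspaces $\mathcal{E}^H\subset\mathcal{E}^h$ and $\mathcal{F}^H\subset\mathcal{F}^h$ are given by bases of linearly independent vectors $\{\mathbf q_{T,i}\}_{i=1}^{m_T}$ on the edofs of each $T$ and $\{\mathbf q_{F,i}\}_{i=1}^{m_F}$ on the bdofs of each $F$; $\mathcal{P}_T$, $\mathcal{P}_F$ are the matrices with these columns, and $\mathcal{P}_e=\operatorname{diag}(\mathcal{P}_T)_T$, $\mathcal{P}_b=\operatorname{diag}(\mathcal{P}_F)_F$ the prolongations. Elements of $\mathcal{E}^H,\mathcal{F}^H$ are identified with their coefficient vectors in these bases. $D_F$ is the restriction of the diagonal of $A$ to the bdofs of $F$. It is assumed that $\mathcal{F}^H$ contains the constants on each $F$ and that $\operatorname{span}\{\mathbf q_{F,i}\}$ is a proper subspace of the trace space on $F$ of $\mathcal{E}^H$. **Mortar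 matrix.** On $\mathcal{E}^H\times[\mathcal{F}^H]^2\times\mathcal{F}^H$, where $[\mathcal{F}^H]^2$ is the space of multipliers $\boldsymbol\mu=(\boldsymbol\mu_{T,F})_{T\in\mathcal{T}^H,F\subset\partial T}$, $\boldsymbol\mu_{T,F}\in\mathbb{R}^{m_F}$, let $$\mathcal{A}=\begin{bmatrix}\mathcal{A}_{ee}&C^T&\\ C&&-X\\ &-X^T&\end{bmatrix},$$ with $\mathbf v^T\mathcal{A}_{ee}\mathbf u=\sum_T[(\mathcal{P}_e\mathbf v)|_T]^TA_T(\mathcal{P}_e\mathbf u)|_T$, $\boldsymbol\mu^TC\mathbf u=\sum_T\sum_{F\subset\partial T}(\mathcal{P}_F\boldsymbol\mu_{T,F})^TD_F((\mathcal{P}_e\mathbf u)|_T)|_F$, and $\boldsymbol\mu^TX\mathbf p=\sum_T\sum_{F\subset\partial T}(\mathcal{P}_F\boldsymbol\mu_{T,F})^TD_F(\mathcal{P}_b\mathbf p)|_F$. The formulation is assumed not over-constrained, i.e. $C$ has full row rank; $\mathcal{A}$ is then invertible (generally indefinite). **Transfer operators.** $\Pi_{h,e}:\mathcal{E}^h\to\mathcal{U}^h$ is averaging: $(\Pi_{h,e}\hat{\mathbf v})_l=\frac1{|J_l|}\sum_{j\in J_l}(\hat{\mathbf v})_j$ for each dof $l$; and $\Pi_H=[\Pi_{h,e}\mathcal{P}_e,\,O,\,O]:\mathcal{E}^H\times[\mathcal{F}^H]^2\times\mathcal{F}^H\to\mathcal{U}^h$. *)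

(* Defs.v *)
From mathcomp Require Import all_boot all_order all_algebra.
From mathcomp Require Import all_classical all_reals all_analysis.
From mathcomp Require mpoly.

Set Implicit Arguments.
Unset Strict Implicit.
Unset Printing Implicit Defensive.

Import Order.TTheory GRing.Theory Num.Theory.
Import numFieldNormedType.Exports.

Local Open Scope classical_set_scope.
Local Open Scope ring_scope.

(* The ambient space is 'rV[R]_d.+1, so its dimension d.+1 is any integer >= 1;
   a d.+1-simplex then has d.+2 vertices and its facets have d.+1 vertices. *)

Notation borelRV R d := (g_sigma_algebraType (@open 'rV[R]_d.+1)).

(* The Lebesgue measure on the Borel sets of R^(d+1), by its characteristic
   property: it is the only Borel measure giving boxes their volume. *)
Definition is_lebesgue (R : realType) (d : nat)
    (mu : {measure set (borelRV R d) -> \bar R}) : Prop :=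
  forall a b : 'rV[R]_d.+1, (forall i, a ord0 i <= b ord0 i) ->
  mu [set x : 'rV[R]_d.+1 | forall i, a ord0 i <= x ord0 i <= b ord0 i]
  = (\prod_i (b ord0 i - a ord0 i))%:E.

(* Locally, after an orthogonal change of coordinates y |-> y *m Q, Omega is
   the set of points strictly above a Lipschitz graph over the last d
   coordinates. *)
Definition lipschitz_boundary (R : realType) (d : nat)
    (Omega : set 'rV[R]_d.+1) : Prop :=
  forall z, (closure Omega `\` Omega) z ->
  exists (Q : 'M[R]_d.+1) (g : 'rV[R]_d -> R) (L : R) (U : set 'rV[R]_d.+1),
  [/\ Q *m Q^T = 1%:M,
      forall s t, `|g s - g t| <= L * `|s - t|,
      nbhs z U &
      forall y, U y ->
        (Omega y <-> g (col' ord0 (y *m Q)) < (y *m Q) ord0 ord0)].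

Definition lipschitz_domain (R : realType) (d : nat)
    (Omega : set 'rV[R]_d.+1) : Prop :=
  [/\ Omega !=set0, open Omega, connected Omega & lipschitz_boundary Omega].

(* Convex hull of the points v j, j \in J. *)
Definition hull (R : realType) (d m : nat) (v : 'I_m -> 'rV[R]_d.+1)
    (J : {set 'I_m}) : set 'rV[R]_d.+1 :=
  [set x | exists c : 'I_m -> R,
    [/\ forall j, 0 <= c j, forall j, j \notin J -> c j = 0,
        \sum_j c j = 1 & x = \sum_j c j *: v j]].

Definition affine_indep (R : realType) (d m : nat)
    (v : 'I_m -> 'rV[R]_d.+1) : Prop :=
  forall c : 'I_m -> R, \sum_j c j = 0 -> \sum_j c j *: v j = 0 ->
  forall j, c j = 0.

Section Mesh.
Context (R : realType) (d ne : nat) (vert : 'I_ne -> 'I_d.+2 -> 'rV[R]_d.+1).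

Definition elt (e : 'I_ne) : set 'rV[R]_d.+1 := hull (vert e) [set: 'I_d.+2]%SET.

Definition shared (e e' : 'I_ne) : {set 'I_d.+2} :=
  [set j | [exists j', vert e j == vert e' j']]%SET.

Record is_triangulation (Omega : set 'rV[R]_d.+1) : Prop := IsTriangulation {
  tri_simplex : forall e, affine_indep (vert e);
  tri_distinct : forall e e', e != e' -> shared e e' != [set: 'I_d.+2]%SET;
  tri_conforming : forall e e',
    elt e `&` elt e' = hull (vert e) (shared e e');
  tri_cover : closure Omega = \bigcup_e elt e }.

Definition fine_face (e e' : 'I_ne) : bool :=
  (e != e') && (#|shared e e'| == d.+1).

(* U^h of degree k. For continuous piecewise polynomials, belonging to H^1_0
   is vanishing on the boundary. Only values on the closure of Omega matter. *)
Definition in_Uh (Omega : set 'rV[R]_d.+1) (k : nat)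
    (u : 'rV[R]_d.+1 -> R) : Prop :=
  [/\ {within closure Omega, continuous u},
      forall e, exists p : mpoly.mpoly d.+1 R,
        all (fun m => (mpoly.mdeg m <= k)%N) (mpoly.msupp p) /\
        (forall x, elt e x -> u x = mpoly.meval (fun i => x ord0 i) p) &
      forall x, (closure Omega `\` Omega) x -> u x = 0].

(* Lagrange nodes of degree k: barycentric coordinates in (1/k)N. *)
Definition lagrange_node (k : nat) (x : 'rV[R]_d.+1) : Prop :=
  exists (e : 'I_ne) (c : 'I_d.+2 -> nat),
    (\sum_j c j)%N = k /\ x = \sum_j ((c j)%:R / k%:R) *: vert e j.

End Mesh.

Record fe_data (R : realType) (d : nat) := FEData {
  Omega : set 'rV[R]_d.+1;
  mu : {measure set (borelRV R d) -> \bar R};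
  kappa : 'rV[R]_d.+1 -> R;
  nelt : nat;
  vert : 'I_nelt -> 'I_d.+2 -> 'rV[R]_d.+1;
  deg : nat;
  ndof : nat;
  node : 'I_ndof -> 'rV[R]_d.+1;
  shape : 'I_ndof -> 'rV[R]_d.+1 -> R; (* nodal basis of U^h *)
  nagg : nat;
  agg : 'I_nelt -> 'I_nagg (* the agglomerate containing an element *) }.
Arguments vert {R d} _.
Arguments node {R d} _.
Arguments shape {R d} _.
Arguments agg {R d} _.

Section Algebra.
Context (R : realType) (d : nat) (D : fe_data R d).

Definition Treg (T : 'I_(nagg D)) : set 'rV[R]_d.+1 :=
  \bigcup_(e in [set e | agg D e = T]) elt (vert D) e.

Record is_fe_problem : Prop := IsFEProblem {
  fe_domain : lipschitz_domain (Omega D);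
  fe_lebesgue : is_lebesgue (mu D);
  fe_kappa_meas :
    measurable_fun (Omega D : set (borelRV R d)) (kappa D : borelRV R d -> R);
  fe_kappa_bounded : exists K : R,
    {ae mu D, forall x, Omega D x -> `|kappa D x| <= K};
  fe_kappa_pos : {ae mu D, forall x, Omega D x -> 0 < kappa D x};
  fe_triangulation : is_triangulation (vert D) (Omega D);
  fe_deg : (0 < deg D)%N;
  (* Dirichlet nodes carry no degree of freedom *)
  fe_node_inj : injective (node D);
  fe_nodeP : forall x, (exists l, node D l = x) <->
    lagrange_node (vert D) (deg D) x /\ Omega D x;
  fe_shape_Uh : forall l, in_Uh (vert D) (Omega D) (deg D) (shape D l);
  fe_shape_node : forall l m, shape D l (node D m) = (l == m)%:R;
  fe_agg_surj : forall T, exists e, agg D e = T;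
  fe_agg_connected : forall T, connected (Treg T) }.

(* The integral of kappa grad u . grad v over a union of elements, computed
   over their interiors: the rest is Lebesgue-null, and that is where the
   gradient of a piecewise polynomial may fail to exist. *)
Definition a_form (E : {set 'I_(nelt D)}) (u v : 'rV[R]_d.+1 -> R) : R :=
  \sum_(e in E) \int[mu D]_(x in (interior (elt (vert D) e) : set (borelRV R d)))
    (kappa D x * \sum_(i < d.+1)
      'D_(delta_mx ord0 i : 'rV[R]_d.+1) u (x : 'rV[R]_d.+1) *
      'D_(delta_mx ord0 i : 'rV[R]_d.+1) v (x : 'rV[R]_d.+1)).

Definition stiffness : 'M[R]_(ndof D) :=
  \matrix_(l, m) a_form [set: 'I_(nelt D)]%SET (shape D l) (shape D m).

(* Local dofs are numbered by enum_val on the set of dofs contained in T. *)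
Definition Tdofs (T : 'I_(nagg D)) : {set 'I_(ndof D)} :=
  [set l | `[< Treg T (node D l) >]]%SET.

Definition local_stiffness (T : 'I_(nagg D)) : 'M[R]_(#|Tdofs T|) :=
  \matrix_(i, j) a_form [set e | agg D e == T]%SET
    (shape D (enum_val i)) (shape D (enum_val j)).

(* The agglomerate faces: one for each unordered pair of agglomerates with a
   common fine face, represented by the pair ordered by index. *)
Definition Phi : {set 'I_(nagg D) * 'I_(nagg D)} :=
  [set p : 'I_(nagg D) * 'I_(nagg D) | (p.1 < p.2)%N &&
    [exists e, exists e',
      [&& agg D e == p.1, agg D e' == p.2 & fine_face (vert D) e e']]]%SET.

Definition Tplus (F : 'I_#|Phi|) : 'I_(nagg D) := (enum_val F).1.
Definition Tminus (F : 'I_#|Phi|) : 'I_(nagg D) := (enum_val F).2.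

Definition Freg (F : 'I_#|Phi|) : set 'rV[R]_d.+1 :=
  [set x | exists e e', [/\ agg D e = Tplus F, agg D e' = Tminus F,
    fine_face (vert D) e e' & (elt (vert D) e `&` elt (vert D) e') x]].

Definition Fdofs (F : 'I_#|Phi|) : {set 'I_(ndof D)} :=
  [set l | `[< Freg F (node D l) >]]%SET.

(* v |-> v|_F for a vector v of dofs of T; used for F on the boundary of T. *)
Definition trace_mx (F : 'I_#|Phi|) (T : 'I_(nagg D)) :
    'M[R]_(#|Fdofs F|, #|Tdofs T|) :=
  \matrix_(i, j) (enum_val i == enum_val j)%:R.

Definition DF (F : 'I_#|Phi|) : 'M[R]_(#|Fdofs F|) :=
  diag_mx (\row_i stiffness (enum_val i) (enum_val i)).

(* The pairs (T, F) with F on the boundary of T, indexing [F^H]^2. *)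
Definition TF : {set 'I_(nagg D) * 'I_#|Phi|} :=
  [set p : 'I_(nagg D) * 'I_#|Phi|
     | (p.1 == Tplus p.2) || (p.1 == Tminus p.2)]%SET.
Definition TF_T (k : 'I_#|TF|) : 'I_(nagg D) := (enum_val k).1.
Definition TF_F (k : 'I_#|TF|) : 'I_#|Phi| := (enum_val k).2.

(* Bases of E^H and F^H, as the columns of P_T and P_F. *)
Record coarse_data := CoarseData {
  mT : 'I_(nagg D) -> nat;
  PT : forall T, 'M[R]_(#|Tdofs T|, mT T);
  mF : 'I_#|Phi| -> nat;
  PF : forall F, 'M[R]_(#|Fdofs F|, mF F) }.

Context (S : coarse_data).

Record is_coarse_data : Prop := IsCoarseData {
  cs_PT_free : forall T, row_free (PT S T)^T;
  cs_PF_free : forall F, row_free (PF S F)^T;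
  cs_const : forall F, exists c : 'cV_(mF S F), PF S F *m c = const_mx 1;
  (* the trace space of E^H on F is spanned by the traces from both sides *)
  cs_proper : forall F,
    ((PF S F)^T < (trace_mx F (Tplus F) *m PT S (Tplus F))^T
                + (trace_mx F (Tminus F) *m PT S (Tminus F))^T)%MS }.

(* diag(P_T): submxcol 1%:M T extracts the T-block of a block vector. *)
Definition Pe : 'M[R]_(\sum_T #|Tdofs T|, \sum_T mT S T) :=
  \mxcol_T (PT S T *m submxcol 1%:M T).

Definition Pb : 'M[R]_(\sum_F #|Fdofs F|, \sum_F mF S F) :=
  \mxcol_F (PF S F *m submxcol 1%:M F).

Definition Aee : 'M[R]_(\sum_T mT S T) :=
  \sum_T (submxcol Pe T)^T *m local_stiffness T *m submxcol Pe T.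

Definition Cmx : 'M[R]_(\sum_(k < #|TF|) mF S (TF_F k), \sum_T mT S T) :=
  \mxcol_k ((PF S (TF_F k))^T *m DF (TF_F k)
            *m (trace_mx (TF_F k) (TF_T k) *m submxcol Pe (TF_T k))).

Definition Xmx : 'M[R]_(\sum_(k < #|TF|) mF S (TF_F k), \sum_F mF S F) :=
  \mxcol_k ((PF S (TF_F k))^T *m DF (TF_F k) *m submxcol Pb (TF_F k)).

Definition mortar : 'M[R]_(\sum_T mT S T
    + (\sum_(k < #|TF|) mF S (TF_F k) + \sum_F mF S F)) :=
  block_mx Aee            (row_mx Cmx^T 0)
           (col_mx Cmx 0) (block_mx 0 (- Xmx) (- Xmx^T) 0).

Definition copies (l : 'I_(ndof D)) : {set 'I_(\sum_T #|Tdofs T|)} :=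
  [set j | enum_val (tagnat.sig2 j) == l]%SET.

Definition Pi_he : 'M[R]_(ndof D, \sum_T #|Tdofs T|) :=
  \matrix_(l, j) (#|copies l|%:R^-1 * (j \in copies l)%:R).

Definition Pi_H : 'M[R]_(ndof D, \sum_T mT S T
    + (\sum_(k < #|TF|) mF S (TF_F k) + \sum_F mF S F)) :=
  row_mx (Pi_he *m Pe) (row_mx 0 0).

End Algebra.

Definition spd (R : realType) (n : nat) (B : 'M[R]_n) : Prop :=
  B^T = B /\
  forall x : 'cV[R]_n, x != 0 -> 0 < (x^T *m B *m x) ord0 ord0.

Section Preconditioners.
Context (R : realType) (d : nat) (D : fe_data R d) (S : coarse_data D).
Context (M : 'M[R]_(ndof D)).
Local Notation A := (stiffness D).

Definition Mbar : 'M[R]_(ndof D) := M *m invmx (M + M^T - A) *m M^T.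

Definition Badd_inv : 'M[R]_(ndof D) :=
  invmx Mbar + Pi_H S *m invmx (mortar S) *m (Pi_H S)^T.

Definition Bmult_inv : 'M[R]_(ndof D) :=
  invmx Mbar + (1%:M - invmx M^T *m A) *m Pi_H S *m invmx (mortar S)
               *m (Pi_H S)^T *m (1%:M - A *m invmx M).

End Preconditioners.

(* Main.v *)
(* Write f = Pi_H^T b = (g, 0, 0) and let (u, l, p) = mortar^-1 f. The last two
   block rows give C u = X p and X^T l = 0, so the multiplier term u^T C^T l
   vanishes and f^T mortar^-1 f = u^T Aee u >= 0: although mortar is indefinite,
   Pi_H mortar^-1 Pi_H^T is positive semidefinite. It remains to add the positive
   definite matrix Mbar^-1 = M^-T (M + M^T - A) M^-1.

   The semidefiniteness of A and of the A_T requires the energy to be integrable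
   on each element, and kappa to be positive there: the interior of an element
   lies in Omega because Omega has a Lipschitz boundary. *)
Require Import Defs.
From mathcomp Require Import all_boot all_order all_algebra.
From mathcomp Require Import all_classical all_reals all_analysis.
From mathcomp Require Import measurable_realfun lra.
From mathcomp Require mpoly.
Import Order.TTheory GRing.Theory Num.Theory.
Import numFieldNormedType.Exports.

Set Implicit Arguments.
Unset Strict Implicit.
Unset Printing Implicit Defensive.

Local Open Scope classical_set_scope.
Local Open Scope ring_scope.

(** * Quadratic forms, congruences and the saddle-point compression *)

Section Psd.
Context {R : realType}.

Definition qform (n : nat) (B : 'M[R]_n) (x : 'cV[R]_n) : R :=
  (x^T *m B *m x) ord0 ord0.

Definition psd (n : nat) (B : 'M[R]_n) : Prop :=
  B^T = B /\ forall x, 0 <= qform B x.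

Lemma qform_congr (m n : nat) (P : 'M[R]_(m, n)) (B : 'M[R]_n) x :
  qform (P *m B *m P^T) x = qform B (P^T *m x).
Proof. by rewrite /qform trmx_mul trmxK !mulmxA. Qed.

Lemma qformD (n : nat) (B C : 'M[R]_n) x :
  qform (B + C) x = qform B x + qform C x.
Proof. by rewrite /qform mulmxDr mulmxDl mxE. Qed.

Lemma qformN (n : nat) (B : 'M[R]_n) x : qform (- B) x = - qform B x.
Proof. by rewrite /qform mulmxN mulNmx mxE. Qed.

Lemma qform_tr (n : nat) (B : 'M[R]_n) x : qform B^T x = qform B x.
Proof.
have -> : qform B x = ((x^T *m B *m x)^T) ord0 ord0 by rewrite /qform [RHS]mxE.
by rewrite /qform !trmx_mul trmxK mulmxA.
Qed.

Lemma sym_congr (m n : nat) (P : 'M[R]_(m, n)) (B : 'M[R]_n) :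
  B^T = B -> (P *m B *m P^T)^T = P *m B *m P^T.
Proof. by move=> sB; rewrite !trmx_mul trmxK sB mulmxA. Qed.

Lemma psd_congr (m n : nat) (P : 'M[R]_(m, n)) (B : 'M[R]_n) :
  psd B -> psd (P *m B *m P^T).
Proof.
by move=> [sB pB]; split=> [|x]; [exact: sym_congr | rewrite qform_congr].
Qed.

Lemma psd_sum (I : finType) (n : nat) (B : I -> 'M[R]_n) :
  (forall i, psd (B i)) -> psd (\sum_i B i).
Proof.
move=> pB; elim/big_ind: _ => [|B1 B2 [s1 p1] [s2 p2]|i _]; last exact: pB.
- by split=> [|x]; rewrite ?trmx0 // /qform mulmx0 mul0mx mxE.
- split=> [|x]; first by rewrite linearD /= s1 s2.
  by rewrite qformD addr_ge0.
Qed.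

Lemma spd_addr (n : nat) (B C : 'M[R]_n) : spd B -> psd C -> spd (B + C).
Proof.
move=> [sB pB] [sC pC]; split=> [|x x0]; first by rewrite linearD /= sB sC.
by rewrite -/(qform (B + C) x) qformD ltr_wpDr ?pC ?pB.
Qed.

(** A nonzero row of the left kernel of [B] would give a zero of the quadratic form. Symmetry is not
    assumed, so that the smoother [M] is covered. *)
Lemma qform_unitmx (n : nat) (B : 'M[R]_n) :
  (forall x, x != 0 -> 0 < qform B x) -> B \in unitmx.
Proof.
move=> pB; rewrite -row_free_unit -kermx_eq0; apply/eqP/row_matrixP => i.
rewrite row0; apply/eqP; apply: contraT => ri0.
have := pB (row i (kermx B))^T; rewrite trmx_eq0 => /(_ ri0).
by rewrite /qform trmxK -row_mul mulmx_ker row0 mul0mx mxE ltxx.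
Qed.

(** The inverse is congruent to the matrix itself: [B^-1 = B^-1 B B^-T]. *)
Lemma spd_invmx (n : nat) (B : 'M[R]_n) : spd B -> spd (invmx B).
Proof.
move=> [sB pB]; have uB : B \in unitmx by exact: qform_unitmx.
have sI : (invmx B)^T = invmx B by rewrite trmx_inv sB.
split=> // x x0; rewrite -/(qform _ x).
have -> : invmx B = invmx B *m B *m (invmx B)^T by rewrite sI mulVmx // mul1mx.
rewrite qform_congr sI; apply: pB; apply: contra x0 => /eqP Bx0.
by rewrite -[x](mulKVmx uB) Bx0 mulmx0.
Qed.

(* [invmx] returns a singular matrix unchanged; the compression is then that of
   the leading block [E]. *)
Lemma psd_saddle_congr (n m p q : nat) (P : 'M[R]_(q, n)) (E : 'M[R]_n)
    (C : 'M[R]_(m, n)) (X : 'M[R]_(m, p)) :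
  psd E ->
  psd (row_mx P (row_mx 0 0) *m
       invmx (block_mx E (row_mx C^T 0)
                (col_mx C 0) (block_mx 0 (- X) (- X^T) 0)) *m
       (row_mx P (row_mx 0 0))^T).
Proof.
move=> [sE pE]; set S := block_mx E _ _ _; set Q := row_mx P _.
have sS : S^T = S.
  rewrite /S tr_block_mx sE tr_col_mx tr_row_mx trmxK tr_block_mx.
  by rewrite !linearN /= trmxK !trmx0.
have [uS | nuS] := boolP (S \in unitmx); last first.
  have -> : invmx S = S by rewrite /invmx (negbTE nuS).
  have -> : Q *m S *m Q^T = P *m E *m P^T.
    rewrite /Q /S row_mx0 mul_row_block !mul0mx !addr0 tr_row_mx mul_row_col.
    by rewrite trmx0 mulmx0 addr0.
  exact: psd_congr.
split=> [|x]; first by apply: sym_congr; rewrite trmx_inv sS.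
rewrite qform_congr; set f := Q^T *m x; set y := invmx S *m f.
(* By symmetry of [S], [f^T S^-1 f = y^T S y], so only the block equations for [y] have to be
   studied. *)
have -> : qform (invmx S) f = qform S y.
  rewrite /qform; have -> : y^T *m S = f^T.
    by rewrite trmx_mul trmx_inv sS mulmxKV.
  by rewrite -mulmxA.
have : S *m y = f by rewrite mulKVmx.
have fE : f = col_mx (P^T *m x) 0.
  by rewrite /f /Q row_mx0 tr_row_mx mul_col_mx trmx0 mul0mx.
rewrite fE; move: y => {f fE} y; rewrite -[y]vsubmxK -[dsubmx y]vsubmxK.
set u := usubmx y; set l := usubmx _; set r := dsubmx _ => Sy.
have [CuXr Xl] : C *m u - X *m r = 0 /\ X^T *m l = 0.
  move: Sy; rewrite /S mul_block_col mul_row_col mul0mx addr0 mul_col_mx.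
  rewrite mul0mx mul_block_col !mul0mx addr0 add0r add_col_mx add0r !mulNmx.
  move=> /eq_col_mx[_]; rewrite -col_mx0 => /eq_col_mx[-> /eqP].
  by rewrite oppr_eq0 => /eqP.
have -> : qform (block_mx E (row_mx C^T 0) (col_mx C 0)
    (block_mx 0 (- X) (- X^T) 0)) (col_mx u (col_mx l r)) = qform E u.
  rewrite /qform -mulmxA mul_block_col mul_row_col mul0mx addr0 mul_col_mx.
  rewrite mul0mx mul_block_col !mul0mx addr0 add0r add_col_mx add0r !mulNmx.
  rewrite CuXr Xl oppr0 !col_mx0 tr_col_mx mul_row_col mulmx0 addr0 mulmxDr.
  have -> : u^T *m (C^T *m l) = (C *m u)^T *m l by rewrite trmx_mul mulmxA.
  rewrite (subr0_eq CuXr) trmx_mul -(mulmxA r^T) Xl mulmx0 addr0.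
  by rewrite mulmxA.
exact: pE.
Qed.

(** [M] is invertible because [2 x^T M x = x^T (M + M^T - A) x + x^T A x] is positive for nonzero
    [x]. The matrix to invert is then congruent to the inverse of a positive definite one. *)
Lemma spd_smoother (n : nat) (A M : 'M[R]_n) :
  (forall x, 0 <= qform A x) -> spd (M + M^T - A) ->
  spd (invmx (M *m invmx (M + M^T - A) *m M^T)).
Proof.
move=> pA hM; apply: spd_invmx.
have uM : M \in unitmx.
  apply: qform_unitmx => x x0.
  have := hM.2 x x0; rewrite -/(qform _ x) 2!qformD qformN qform_tr subr_gt0.
  move=> /(le_lt_trans (pA x)); rewrite -mulr2n pmulrn_lgt0 //.
have [sN pN] := spd_invmx hM; split=> [|x x0]; first exact: sym_congr.
rewrite -/(qform _ x) qform_congr; apply: pN; apply: contra x0 => /eqP Mx0.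
by rewrite -[x](mulKmx (_ : M^T \in unitmx)) ?unitmx_tr // Mx0 mulmx0.
Qed.

End Psd.

(** * Continuously differentiable functions and polynomials *)

Section C1.
Context {R : realType} {d : nat}.
Implicit Types f g : 'rV[R]_d.+1 -> R.

(** Phrased with directional derivatives, the form in which gradients enter [a_form]. *)
Definition C1 f : Prop :=
  [/\ continuous f, forall x v, derivable f x v &
      forall v, continuous (fun x => 'D_v f x)].

Lemma C1_cst (c : R) : C1 (fun=> c).
Proof.
split=> [|x v|v]; [exact: cst_continuous | exact: derivable_cst |].
have -> : (fun x => 'D_v (fun=> c) x) = (fun=> 0) :> ('rV[R]_d.+1 -> R).
  by apply/funext => x; exact: derive_cst.
exact: cst_continuous.
Qed.

Lemma C1_coord (i : 'I_d.+1) : C1 (fun x => x ord0 i).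
Proof.
have dc (x v : 'rV[R]_d.+1) :
    is_derive x v (fun x : 'rV[R]_d.+1 => x ord0 i) (v ord0 i).
  apply: DeriveDef.
    apply/cvg_ex; exists (v ord0 i).
    (* For [h != 0] the difference quotient of a coordinate is exactly [v ord0 i]. *)
    apply: cvg_near_cst; near=> h.
    rewrite /= !mxE addrK /GRing.scale /= mulKf //; near: h.
    exact: nbhs_dnbhs_neq.
  apply: cvg_lim => //.
  apply: cvg_near_cst; near=> h.
  rewrite /= !mxE addrK /GRing.scale /= mulKf //; near: h.
  exact: nbhs_dnbhs_neq.
split=> [|x v|v]; [exact: coord_continuous | by case: (dc x v) |].
have -> : (fun x => 'D_v (fun x : 'rV[R]_d.+1 => x ord0 i) x) = cst (v ord0 i).
  by apply/funext => x; case: (dc x v).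
exact: cst_continuous.
Unshelve. all: by end_near. Qed.

Lemma C1D f g : C1 f -> C1 g -> C1 (fun x => f x + g x).
Proof.
move=> [cf df f1] [cg dg g1]; split=> [x|x v|v].
- exact: (cvgD (cf x) (cg x)).
- exact: derivableD.
- have -> : (fun x => 'D_v (fun y => f y + g y) x)
    = (fun x => 'D_v f x + 'D_v g x).
    by apply/funext => x; exact: deriveD.
  by move=> x; exact: (cvgD (f1 v x) (g1 v x)).
Qed.

Lemma C1M f g : C1 f -> C1 g -> C1 (fun x => f x * g x).
Proof.
move=> [cf df f1] [cg dg g1]; split=> [x|x v|v].
- exact: (cvgM (cf x) (cg x)).
- exact: derivableM.
- have -> : (fun x => 'D_v (fun y => f y * g y) x)
    = (fun x => f x * 'D_v g x + g x * 'D_v f x).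
    by apply/funext => x; exact: deriveM.
  by by move=> x; exact: (cvgD (cvgM (cf x) (g1 v x)) (cvgM (cg x) (f1 v x))).
Qed.

Lemma C1_sum (I : Type) (r : seq I) (F : I -> 'rV[R]_d.+1 -> R) :
  (forall i, C1 (F i)) -> C1 (fun x => \sum_(i <- r) F i x).
Proof.
move=> cF; elim: r => [|i r IH].
  by under eq_fun do rewrite big_nil; exact: C1_cst.
by under eq_fun do rewrite big_cons; exact: C1D.
Qed.

Lemma C1_prod (I : Type) (r : seq I) (F : I -> 'rV[R]_d.+1 -> R) :
  (forall i, C1 (F i)) -> C1 (fun x => \prod_(i <- r) F i x).
Proof.
move=> cF; elim: r => [|i r IH].
  by under eq_fun do rewrite big_nil; exact: C1_cst.
by under eq_fun do rewrite big_cons; exact: C1M.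
Qed.

Lemma C1X f n : C1 f -> C1 (fun x => f x ^+ n).
Proof.
move=> cf; elim: n => [|n IH].
  by under eq_fun do rewrite expr0; exact: C1_cst.
by under eq_fun do rewrite exprS; exact: C1M.
Qed.

(** A polynomial is a sum of products of powers of coordinates. This supplies the regularity of the
    shape functions inside an element. *)
Lemma C1_meval (p : mpoly.mpoly d.+1 R) :
  C1 (fun x => mpoly.meval (fun i => x ord0 i) p).
Proof.
under eq_fun do rewrite mpoly.mevalE.
apply: C1_sum => m; apply: C1M; first exact: C1_cst.
by apply: C1_prod => i; apply: C1X; exact: C1_coord.
Qed.

(** * Borel measurability and bounds on cubes *)

Lemma continuous_borel_measurable f :
  continuous f -> measurable_fun setT (f : borelRV R d -> R).
Proof.
move=> /continuousP cf.
apply: (measurability _ (RGenOpens.measurableE R)) => _ [_ [a [b ->] <-]].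
rewrite setTI; apply: sub_sigma_algebra; apply: cf; exact: interval_open.
Qed.

(** A cube written coordinatewise, the kind of set whose volume [is_lebesgue] prescribes. *)
Definition box (B : R) : set 'rV[R]_d.+1 :=
  [set x | forall i, - B <= x ord0 i <= B].

Lemma compact_box B : compact (box B).
Proof.
have -> : box B = [set x | forall i, `[- B, B]%classic (x ord0 i)].
  by apply/seteqP; split=> x /= Bx i; have := Bx i; rewrite in_itv.
by apply: (@rV_compact _ _ (fun=> `[- B, B]%classic)) => i; exact: segment_compact.
Qed.

Lemma continuous_box_bounded f B : continuous f ->
  exists K : R, forall x, box B x -> `|f x| <= K.
Proof.
move=> cf; have := @compact_bounded R R^o _ (@continuous_compact _ _ f _
  (continuous_subspaceT cf) (@compact_box B)).
move=> [M [_ /(_ (M + 1))]]; rewrite ltrDl ltr01 => /(_ isT) bM.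
by exists (M + 1) => x Bx; apply: bM; exists x.
Qed.

Lemma measurable_box B : measurable (box B : set (borelRV R d)).
Proof.
rewrite -[box B]setCK; apply: measurableC; apply: sub_sigma_algebra.
rewrite openC; apply: compact_closed; last exact: compact_box.
exact: norm_hausdorff.
Qed.

(** Convex weights are at most 1, so the sum of all absolute vertex coordinates bounds every
    coordinate of a point of the hull. *)
Lemma hull_sub_box m (v : 'I_m -> 'rV[R]_d.+1) (J : {set 'I_m}) :
  exists2 B, 0 <= B & hull v J `<=` box B.
Proof.
exists (\sum_j \sum_i `|v j ord0 i|).
  by apply: sumr_ge0 => j _; apply: sumr_ge0.
move=> x [c [c0 _ c1 ->]] i; rewrite -ler_norml summxE.
apply: (le_trans (ler_norm_sum _ _ _)); apply: ler_sum => j _.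
rewrite mxE normrM ger0_norm //.
have c1j : c j <= 1.
  by rewrite -c1 (bigD1 j) //= lerDl sumr_ge0.
apply: (le_trans (ler_piMl _ c1j)) => //.
by rewrite (bigD1 i) //= lerDl sumr_ge0.
Qed.

(** * Interior of the closure of a Lipschitz domain *)

Lemma mulmxr_lipschitz (Q : 'M[R]_d.+1) : exists2 K, 0 <= K &
  forall (v : 'rV[R]_d.+1) j, `|(v *m Q) ord0 j| <= K * `|v|.
Proof.
exists (\sum_j \sum_i `|Q i j|).
  by apply: sumr_ge0 => j _; apply: sumr_ge0.
move=> v j; rewrite mxE (le_trans (ler_norm_sum _ _ _)) //.
rewrite [X in _ <= X * _](bigD1 j) //= mulrDl; apply: ler_wpDr.
  by apply: mulr_ge0 => //; apply: sumr_ge0 => k _; apply: sumr_ge0.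
rewrite mulr_suml; apply: ler_sum => i _.
rewrite normrM mulrC ler_wpM2l // [leRHS]/Num.norm /= mx_normrE.
by apply/bigmax_geP; right => /=; exists (ord0, i).
Qed.

(* Around a boundary point z interior to the closure there would be points of
   the closure strictly below the graph, hence also points of Omega. *)
Lemma interior_closure_lipschitz (Om : set 'rV[R]_d.+1) :
  lipschitz_domain Om -> interior (closure Om) `<=` Om.
Proof.
(* The final contradiction in numbers: [h] stands for heights and [g] for graph values, [a] and [b]
   bound their variation between [y0] and [y], and [e] is the gap at [y0]. *)
have arith (hy0 gy0 hy gy n a b e : R) : hy0 + e <= gy0 -> a + b + n < e ->
  gy < hy -> gy0 - gy <= b -> - a <= hy0 - hy -> 0 <= n -> False by lra.
move=> [_ _ _ lip] z iz; apply: contrapT => nz.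
have cz : closure Om z by exact: interior_subset iz.
have [Q [g [L [U [QQ lg Uz UO]]]]] := lip z (conj cz nz).
have QQ' : Q^T *m Q = 1%:M by exact: mulmx1C.
pose H (y : 'rV[R]_d.+1) := (y *m Q) ord0 ord0.
pose G (y : 'rV[R]_d.+1) := g (col' ord0 (y *m Q)).
have [K K0 KQ] := mulmxr_lipschitz Q.
have HK y t : `|H y - H t| <= K * `|y - t|.
  by rewrite /H (le_trans _ (KQ _ ord0)) // mulmxBl !mxE.
have GK y t : `|G y - G t| <= `|L| * (K * `|y - t|).
  rewrite /G (le_trans (lg _ _)) // (le_trans (ler_wpM2r _ (ler_norm L))) //.
  rewrite ler_wpM2l // [leLHS]/Num.norm /= mx_normrE.
  apply/bigmax_leP; split => [|[i j] _ /=]; first by rewrite mulr_ge0.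
  rewrite ord1 (le_trans _ (KQ _ (lift ord0 j))) // mulmxBl !mxE //.
(* [w] is the vertical axis in the original coordinates: subtracting [e *: w] lowers the height by
   [e] and keeps the base point. *)
pose w : 'rV[R]_d.+1 := delta_mx ord0 ord0 *m Q^T.
have wQ (e : R) : (z - e *: w) *m Q = z *m Q - e *: delta_mx ord0 ord0.
  by rewrite mulmxBl -scalemxAl -mulmxA QQ' mulmx1.
have HGz : H z <= G z.
  rewrite leNgt; apply/negP => Gz; apply: nz; apply/UO => //.
  exact: nbhs_singleton.
have : nbhs z (interior U `&` interior (closure Om)).
  by apply: filterI; exact: nbhs_interior.
move=> /nbhs_ballP[r /= r0]; rewrite -ball_normE /= => rU.
(* Chosen so that [z - e *: w] stays in the ball of radius [r]: [e * |w| < r]. *)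
pose e := r / (`|w| + 1).
have w1 : 0 < `|w| + 1 by rewrite ltr_wpDl.
have e0 : 0 < e by rewrite divr_gt0.
have [/= Uy0 cy0] : (interior U `&` interior (closure Om)) (z - e *: w).
  apply: rU => /=; rewrite opprB addrC subrK normrZ gtr0_norm //.
  by rewrite /e mulrAC ltr_pdivrMr // ltr_pM2l // ltrDl.
set y0 := z - e *: w in Uy0 cy0.
have HG0 : H y0 + e <= G y0.
  have -> : H y0 = H z - e by rewrite /H wQ !mxE !eqxx mulr1.
  have -> : G y0 = G z.
    rewrite /G wQ; congr g; apply/matrixP => i j.
    by rewrite !mxE andbF mulr0 subr0.
  by rewrite subrK.
(* [K + |L| * K] bounds the total variation rate of the height and of the graph; the added 1 keeps
   [K'] positive. Within distance [e / K'] of [y0] the gap [e] cannot close. *)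
pose K' := K + `|L| * K + 1.
have K'0 : 0 < K' by rewrite ltr_wpDl // addr_ge0 // mulr_ge0.
(* [y0] lies in the closure of [Om], so points of [Om] come arbitrarily near it. *)
have [y [Oy [yU yb]]] : Om `&` (U `&` ball y0 (e / K')) !=set0.
  apply: (interior_subset cy0); apply: filterI => //.
  by apply: nbhsx_ballx; rewrite divr_gt0.
move: yb; rewrite -ball_normE /= ltr_pdivlMr // => yb.
move: ((UO y yU).1 Oy); rewrite -/(G y) -/(H y) => GH.
have := HK y0 y; have := GK y0 y; rewrite !ler_norml.
move=> /andP[_ b1] /andP[b2 _].
have ny : 0 <= `|y0 - y| by [].
have {}yb : K * `|y0 - y| + `|L| * (K * `|y0 - y|) + `|y0 - y| < e.
  by move: yb; rewrite /K' mulrC !mulrDl mul1r mulrA.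
exact: arith HG0 yb GH b1 b2 ny.
Qed.

End C1.

(** * Nonnegativity of Gram sums of integrals *)

Section Gram.
Context {R : realType} {disp : measure_display} {T : measurableType disp}.
Context (nu : {measure set T -> \bar R}) (E : set T) (mE : measurable E).

(** Carries integrability along with the value, since additivity of the integral needs both at each
    step of an induction. *)
Let integral_of (g : T -> R) (v : R) : Prop :=
  nu.-integrable E (EFin \o g) /\ (\int[nu]_(x in E) g x)%R = v.

Let integral_of_sum (I : Type) (r : seq I) (g : I -> T -> R) v :
  (forall i, integral_of (g i) (v i)) ->
  integral_of (fun x => \sum_(i <- r) g i x) (\sum_(i <- r) v i).
Proof.
move=> gv; elim: r => [|i r [int_r IH]].
  under eq_fun do rewrite big_nil; rewrite big_nil.
  by split; [exact: integrable0 | by rewrite /Rintegral integral0].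
under eq_fun do rewrite big_cons; rewrite big_cons.
have [int_i vi] := gv i; split; first exact: (integrableD mE int_i int_r).
by rewrite RintegralD // vi IH.
Qed.

Let integral_ofZ (c : R) (g : T -> R) v :
  integral_of g v -> integral_of (fun x => c * g x) (c * v).
Proof.
move=> [ig vg]; split; first exact: (integrableZl mE c ig).
by rewrite RintegralZl // vg.
Qed.

(** By linearity the double sum is the integral of a single function, which is nonnegative once the
    null set [N] is removed from the domain. *)
Lemma Rintegral_gram_ge0 (n : nat) (N : set T) (f : 'I_n -> 'I_n -> T -> R)
    (c : 'I_n -> R) :
  measurable N -> nu N = 0 ->
  (forall i j, nu.-integrable E (EFin \o f i j)) ->
  (forall x, (E `\` N) x -> 0 <= \sum_i \sum_j c i * c j * f i j x) ->
  0 <= \sum_i \sum_j c i * c j * (\int[nu]_(x in E) f i j x)%R.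
Proof.
move=> mN N0 int_f f0.
have [int_s <-] : integral_of (fun x => \sum_i \sum_j c i * c j * f i j x)
    (\sum_i \sum_j c i * c j * (\int[nu]_(x in E) f i j x)%R).
  by do 2 (apply: integral_of_sum => ?); exact: integral_ofZ.
by rewrite /Rintegral (negligible_integral mN) //; exact: Rintegral_ge0.
Qed.

End Gram.

(** * Integrability and positivity of the energy on elements *)

Section Energy.
Context {R : realType} {d : nat} (D : fe_data R d) (hD : is_fe_problem D).

Let energy l m (x : 'rV[R]_d.+1) : R :=
  kappa D x * \sum_(i < d.+1)
      'D_(delta_mx ord0 i : 'rV[R]_d.+1) (Defs.shape D l) x *
      'D_(delta_mx ord0 i : 'rV[R]_d.+1) (Defs.shape D m) x.

Let E e : set (borelRV R d) := interior (elt (vert D) e).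

Let measurable_E e : measurable (E e).
Proof. by apply: sub_sigma_algebra; exact: open_interior. Qed.

Let E_sub_Omega e : E e `<=` Omega D.
Proof.
move=> x Ex; apply: (interior_closure_lipschitz (fe_domain hD)).
apply: filterS Ex; rewrite (tri_cover (fe_triangulation hD)) => y ey.
by exists e.
Qed.

(** An element lies in a cube, whose volume is finite by [is_lebesgue]. *)
Let mu_E_lty e : (mu D (E e) < +oo)%E.
Proof.
have [B B0 eB] := hull_sub_box (vert D e) [set: 'I_d.+2]%SET.
apply: (@le_lt_trans _ _ (mu D (box B))).
  apply: le_measure; rewrite ?inE //; first exact: measurable_box.
  exact: subset_trans (@interior_subset _ _) eB.
have := fe_lebesgue hD (a := const_mx (- B)) (b := const_mx B).
have -> : [set x : 'rV[R]_d.+1 | forall i,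
    (const_mx (- B) : 'rV[R]_d.+1) ord0 i <= x ord0 i
      <= (const_mx B : 'rV[R]_d.+1) ord0 i] = box B.
  by apply/seteqP; split=> x Bx i; have := Bx i; rewrite !mxE.
move=> -> => [|i]; first exact: ltry.
by rewrite !mxE (le_trans _ B0) // oppr_le0.
Qed.

(** Near each point of the open set [E e] the shape functions coincide with polynomials, hence so do
    their derivatives; [q] is the dot product of the polynomial gradients. [kappa] is kept apart,
    being only measurable. *)
Let grad_dot_continuous e l m : exists2 q : 'rV[R]_d.+1 -> R,
  continuous q & forall x, E e x -> energy l m x = kappa D x * q x.
Proof.
have poly k : exists2 p, C1 p &
    forall x v, E e x -> 'D_v (Defs.shape D k) x = 'D_v p x.
  have [_ /(_ e)[p [_ pE]] _] := fe_shape_Uh hD k.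
  exists (fun x => mpoly.meval (fun i => x ord0 i) p); first exact: C1_meval.
  move=> x v Ex; apply: near_eq_derive.
  by apply: filterS Ex => y; exact: pE.
have [p [_ _ p1] pE] := poly l; have [q [_ _ q1] qE] := poly m.
exists (fun x => \sum_(i < d.+1) 'D_(delta_mx ord0 i : 'rV[R]_d.+1) p x *
  'D_(delta_mx ord0 i : 'rV[R]_d.+1) q x); last first.
  move=> x Ex; rewrite /energy; congr (_ * _); apply: eq_bigr => i _.
  by rewrite pE // qE.
elim: (index_enum _) => [|i r IH].
  by under eq_fun do rewrite big_nil; exact: cst_continuous.
under eq_fun do rewrite big_cons.
by move=> x; exact: (cvgD (cvgM (p1 _ x) (q1 _ x)) (IH x)).
Qed.

(** A single exceptional set serves both the integrability and the sign of the energy. *)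
Let kappa_ae : exists (N : set (borelRV R d)) (K : R),
  [/\ measurable N, mu D N = 0%E &
      forall x, Omega D x -> ~ N x -> 0 < kappa D x <= K].
Proof.
have [K [N1 [mN1 N10 K1]]] := fe_kappa_bounded hD.
have [N2 [mN2 N20 K2]] := fe_kappa_pos hD.
exists (N1 `|` N2), K; split; first exact: measurableU.
  exact: null_set_setU.
move=> x Ox /not_orP[nN1 nN2]; apply/andP; split.
  by apply: contrapT => /= k0; apply: nN2; apply: K2 => /= /(_ Ox).
apply: (le_trans (ler_norm _)).
by apply: contrapT => /= k0; apply: nN1; apply: K1 => /= /(_ Ox).
Qed.

(** Off a null set the integrand is measurable and bounded by [K * Q], with [K] bounding [kappa] and
    [Q] bounding [q] on a cube around the element; the domain has finite measure. *)
Let energy_integrable e l m : (mu D).-integrable (E e) (EFin \o energy l m).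
Proof.
have [q cq qE] := grad_dot_continuous e l m.
have [N [K [mN N0 NK]]] := kappa_ae.
have [B _ eB] := hull_sub_box (vert D e) [set: 'I_d.+2]%SET.
have [Q qQ] := continuous_box_bounded B cq.
have menergy : measurable_fun (E e) (energy l m : borelRV R d -> R).
  apply: (eq_measurable_fun ((kappa D : borelRV R d -> R) \* (q : borelRV R d -> R))).
    by move=> x /[!inE] Ex; rewrite qE.
  apply: measurable_funM.
    apply: measurable_funS (fe_kappa_meas hD); last exact: E_sub_Omega.
    by apply: sub_sigma_algebra; case: (fe_domain hD).
  apply: measurable_funS (continuous_borel_measurable cq) => //.
apply/(negligible_integrable mN) => //; first exact/measurable_EFinP.
apply: measurable_bounded_integrable => //.
- exact: measurableD.
- apply: le_lt_trans (mu_E_lty e); apply: le_measure; rewrite ?inE //.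
  exact: measurableD.
- by apply: measurable_funS menergy.
exists (K * Q); split => [|M KQM x]; first exact: num_real.
move=> [Ex nN].
have /andP[k0 kK] := NK x (E_sub_Omega Ex) nN.
rewrite /= qE // normrM (le_trans _ (ltW KQM)) //.
apply: ler_pM => //; first by rewrite gtr0_norm.
by apply: qQ; apply: eB; exact: interior_subset Ex.
Qed.

(** On each element the integrand is [kappa] times the squared norm of the gradient of the
    combination with coefficients [c]. The selection [s] lets one statement cover global dofs ([id])
    and local ones ([enum_val]). *)
Lemma a_form_gram_ge0 (Es : {set 'I_(nelt D)}) (n : nat)
    (s : 'I_n -> 'I_(ndof D)) (c : 'I_n -> R) :
  0 <= \sum_i \sum_j c i * c j * a_form Es (Defs.shape D (s i)) (Defs.shape D (s j)).
Proof.
rewrite /a_form.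
under eq_bigr do under eq_bigr do rewrite mulr_sumr.
under eq_bigr do rewrite exchange_big.
rewrite exchange_big; apply: sumr_ge0 => e _ /=.
have [N [K [mN N0 NK]]] := kappa_ae.
apply: (@Rintegral_gram_ge0 _ _ _ (mu D) (E e) (measurable_E e) _ N
  (fun i j => energy (s i) (s j))) => // x [Ex nN].
have /andP[k0 _] := NK x (E_sub_Omega Ex) nN.
rewrite /energy; set g := fun l i => 'D_(delta_mx ord0 i) (Defs.shape D l) x.
have -> : \sum_i \sum_j c i * c j * (kappa D x * \sum_k g (s i) k * g (s j) k)
    = kappa D x * \sum_k (\sum_i c i * g (s i) k) ^+ 2.
  under [in RHS]eq_bigr do rewrite expr2 big_distrlr /=.
  rewrite [in RHS]exchange_big mulr_sumr; apply: eq_bigr => i _ /=.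
  rewrite [in RHS]exchange_big mulr_sumr; apply: eq_bigr => j _ /=.
  rewrite mulrCA mulr_sumr; congr (_ * _); apply: eq_bigr => k _.
  by rewrite mulrACA.
by apply: mulr_ge0; [exact: ltW | apply: sumr_ge0 => k _; exact: sqr_ge0].
Qed.

Lemma a_formC (Es : {set 'I_(nelt D)}) u v : a_form Es u v = a_form Es v u.
Proof.
apply: eq_bigr => e _; congr Rintegral; apply/funext => x.
by congr (_ * _); apply: eq_bigr => i _; rewrite mulrC.
Qed.

End Energy.

(** * Semidefiniteness of the assembled matrices *)

Section Assembly.
Context {R : realType} {d : nat} (D : fe_data R d) (hD : is_fe_problem D).

Lemma psd_a_form_gram (Es : {set 'I_(nelt D)}) (n : nat)
    (s : 'I_n -> 'I_(ndof D)) :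
  psd (\matrix_(i, j) a_form Es (Defs.shape D (s i)) (Defs.shape D (s j))).
Proof.
split=> [|x]; first by apply/matrixP => i j; rewrite !mxE a_formC.
rewrite /qform mxE; under eq_bigr do rewrite mxE mulr_suml.
rewrite exchange_big /=.
under eq_bigr do under eq_bigr do rewrite !mxE mulrAC.
exact: (a_form_gram_ge0 hD Es s (fun i => x i ord0)).
Qed.

Lemma psd_stiffness : psd (stiffness D).
Proof. exact: (psd_a_form_gram _ id). Qed.

Lemma psd_Aee (S : coarse_data D) : psd (Aee S).
Proof.
apply: psd_sum => T.
(* The double transpose exhibits the summand as a congruence of [local_stiffness T] by
   [(submxcol (Pe S) T)^T]. *)
rewrite -[X in _ *m _ *m X]trmxK; apply: psd_congr.
exact: psd_a_form_gram.
Qed.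

(** Instance of the saddle-point lemma with [P := Pi_he D *m Pe S], [E := Aee S], [C := Cmx S] and
    [X := Xmx S]. *)
Lemma psd_mortar_correction (S : coarse_data D) :
  psd (Pi_H S *m invmx (mortar S) *m (Pi_H S)^T).
Proof. exact: psd_saddle_congr (psd_Aee S). Qed.

End Assembly.

Theorem proposition5p1 (R : realType) (d : nat)
    (D : fe_data R d) (hD : is_fe_problem D)
    (S : coarse_data D) (hS : is_coarse_data S)
    (hC : row_free (Cmx S))
    (M : 'M[R]_(ndof D)) (hM : spd (M + M^T - stiffness D)) :
  spd (Badd_inv S M) /\ spd (Bmult_inv S M).
Proof.
have [sA pA] := psd_stiffness hD.
have sB : spd (invmx (Mbar M)) by exact: spd_smoother.
have pP := psd_mortar_correction hD S.
split; apply: spd_addr => //.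
(* Since [A] is symmetric, the outer factors of the multiplicative correction are transposes of each
   other, so it is a congruence of the additive correction. *)
have -> : 1%:M - stiffness D *m invmx M
    = (1%:M - invmx M^T *m stiffness D)^T.
  by rewrite linearB /= trmx1 trmx_mul sA trmx_inv trmxK.
by rewrite -!mulmxA (mulmxA (Pi_H S)) (mulmxA (_ *m _)) mulmxA; exact: psd_congr.
Qed.
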